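(* Let $\mathcal{H}$ be a weighted Hardy space in $d$ variables. The following are equivalent: (1) $\operatorname{Mult}(\mathcal{H})$ contains the coordinate functions $z_1,\dots,z_d$. (2) $\operatorname{Mult}(\mathcal{H})$ is a dense subset of $\mathcal{H}$. (3) There exists $c\in\mathcal{H}$ such that $\overline{\operatorname{Mult}(\mathcal{H})c}=\mathcal{H}$. (4) $\mathcal{H}$ is algebraically consistent on its natural maximal domain.
   Context: For $d\in\mathbb{N}$ and $r\in(0,\infty]$ let $r\mathbb{B}_d=\{z\in\mathbb{C}^d:|z|<r\}$ and $\overline{r\mathbb{B}_d}=\{z\in\mathbb{C}^d:|z|\le r\}$ (both equal to $\mathbb{C}^d$ if $r=\infty$); $\langle\cdot,\cdot\rangle_d$ is the standard inner product on $\mathbb{C}^d$. A Hilbert function space (RKHS) on a set $X$ is a Hilbert space of complex functions on $X$ all of whose point evaluations are bounded. Generating function: a power series $G(t)=\sum_{n\ge0}a_nt^n$ with $a_0=1$, $a_n>0$ for all $n$, and radius of convergence in $(0,\infty]$. Weighted Hardy space in $d$ variables: a Hilbert function space of holomorphic functions on a ball $r\mathbb{B}_d$, $r\in(0,\infty]$, in which the monomials $z^\alpha$ form a complete orthogonal set of nonzero vectors with $\|z^\alpha\|^2/\alpha!=\|z^\beta\|^2/\beta!$ whenever $|\alpha|=|\beta|$, and $\|\mathbf{1}\|=1$. Equivalently its reproducing kernel is $K(z,w)=G(\langle z,w\rangle_d)$ for a (unique) generating function $G=\sum a_nt^n$, and then $\|z^\alpha\|^{-2}=a_{|\alpha|}\frac{|\alpha|!}{\alpha!}$.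 Convention: every weighted Hardy space is regarded as a space of functions on its natural maximal domain $X$: if $r^2\in(0,\infty]$ is the radius of convergence of $G$, then $X=\mathbb{C}^d$ if $r=\infty$; $X=r\mathbb{B}_d$ if $r<\infty$ and $G(r^2)=\infty$; $X=\overline{r\mathbb{B}_d}$ if $r<\infty$ and $G(r^2)<\infty$ (functions then extend continuously to the closed ball). $\operatorname{Mult}(\mathcal{H})$ is the set of functions $\lambda:X\to\mathbb{C}$ with $\lambda f\in\mathcal{H}$ for all $f\in\mathcal{H}$; since $\mathbf 1\in\mathcal H$, $\operatorname{Mult}(\mathcal{H})\subseteq\mathcal{H}$. For $c\in\mathcal H$, $\operatorname{Mult}(\mathcal{H})c=\{\lambda c:\lambda\in\operatorname{Mult}(\mathcal{H})\}$, and the bar denotes norm closure in $\mathcal H$. A nonzero bounded linear functional $\rho$ on $\mathcal{H}$ is multiplicative if $\rho(fg)=\rho(f)\rho(g)$ whenever $f,g,fg\in\mathcal{H}$; it is partially multiplicative if $\rho(\phi g)=\rho(\phi)\rho(g)$ whenever $\phi\in\operatorname{Mult}(\mathcal{H})$, $g\in\mathcal{H}$. $\mathcal{H}$ is algebraically consistent (on its natural maximal domain) if every partially multiplicative functional on $\mathcal{H}$ is multiplicative. (The natural maximal domain is a maximal domain: every multiplicative functional on $\mathcal{H}$ is evaluation at some point of $X$.) *)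

(* Defs.v *)
From HB Require Import structures.
From mathcomp Require Import all_boot all_order all_algebra.
From mathcomp Require Import complex.
From mathcomp Require Import all_classical all_reals all_analysis.

Set Implicit Arguments.
Unset Strict Implicit.
Unset Printing Implicit Defensive.

Import Order.TTheory GRing.Theory Num.Theory.
Import numFieldNormedType.Exports.

Local Open Scope classical_set_scope.
Local Open Scope ring_scope.
Local Open Scope complex_scope.

(* The field of scalars is written R[i]^o wherever its topology is needed,
   since only the regular algebra R[i]^o carries the normed structure. *)

Definition bounded_functional (R : realType) (V : normedModType R[i])
    (rho : V -> R[i]) : Prop :=
  exists M : R[i], forall f : V, `|rho f| <= M * `|f|.

(* A Hilbert space of functions on X is a Hilbert space together with an
   injective linear map hfs_eval sending each vector to a function on X. *)
Record hilbert_function_space (R : realType) (X : Type) :=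
  HilbertFunctionSpace {
  hfs_space :> completeNormedModType R[i] ;
  hfs_dot : {dot hfs_space for Num.conj} ;
  hfs_normE : forall f : hfs_space, `|f| ^+ 2 = hfs_dot f f ;
  hfs_eval : {linear hfs_space -> (X -> R[i])} ;
  hfs_eval_inj : injective hfs_eval ;
  hfs_eval_bounded :
    forall x : X, bounded_functional (fun f : hfs_space => hfs_eval f x) }.

Arguments hfs_dot {R X} _.
Arguments hfs_eval {R X} _.

Section HilbertFunctionSpaces.
Variables (R : realType) (X : Type) (H : hilbert_function_space R X).

Local Notation ev := (hfs_eval H).

Definition Mult : set (X -> R[i]) :=
  [set l | forall f : H, range ev (l \* ev f)].

Definition Mult_in_space : set H := [set f | Mult (ev f)].

Definition Mult_orbit (c : H) : set H :=
  [set g | exists2 l, Mult l & ev g = l \* ev c].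

Definition multiplicative_functional (rho : {linear H -> R[i]^o}) : Prop :=
  [/\ bounded_functional rho,
      exists f : H, rho f != 0 &
      forall f g h : H, ev h = ev f \* ev g -> rho h = rho f * rho g].

Definition partially_multiplicative_functional
    (rho : {linear H -> R[i]^o}) : Prop :=
  [/\ bounded_functional rho,
      exists f : H, rho f != 0 &
      forall phi g h : H, Mult (ev phi) ->
        ev h = ev phi \* ev g -> rho h = rho phi * rho g].

Definition algebraically_consistent : Prop :=
  forall rho : {linear H -> R[i]^o},
    partially_multiplicative_functional rho -> multiplicative_functional rho.

End HilbertFunctionSpaces.

Arguments Mult_in_space {R X} H.

(* The value G(t) for t >= 0, which is +oo if the series diverges. It is only
   used for coefficients a_n >= 0, so that the extended real sum is the sum of
   the series and the supremum below is its radius of convergence. *)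
Definition gen_fun (R : realType) (a : nat -> R) (t : R) : \bar R :=
  (\sum_(0 <= n <oo) (a n * t ^+ n)%:E)%E.

Definition conv_radius (R : realType) (a : nat -> R) : \bar R :=
  ereal_sup [set t%:E | t in [set t : R | 0 <= t /\ (gen_fun a t < +oo)%E]].

Definition generating_function (R : realType) (a : nat -> R) : Prop :=
  [/\ a 0%N = 1, forall n, 0 < a n & (0 < conv_radius a)%E].

Section Euclidean.
Variables (R : realType) (d : nat).

(* The square of the Euclidean norm |z|, as opposed to the library norm `|z|
   of row vectors, which is the maximum norm. *)
Definition sqnorm (z : 'rV[R[i]^o]_d) : R :=
  \sum_(i < d) Normc.normc (z ord0 i) ^+ 2.

Definition mono_fun (alpha : {ffun 'I_d -> nat}) (z : 'rV[R[i]^o]_d) : R[i] :=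
  \prod_(i < d) z ord0 i ^+ alpha i.

Definition mono_deg (alpha : {ffun 'I_d -> nat}) : nat :=
  (\sum_(i < d) alpha i)%N.

Definition mono_fact (alpha : {ffun 'I_d -> nat}) : nat :=
  (\prod_(i < d) (alpha i)`!)%N.

(* The radius of convergence in t is r^2, where r is the radius of the ball. *)
Definition natural_domain (a : nat -> R) : set 'rV[R[i]^o]_d :=
  match conv_radius a with
  | r2%:E => if (gen_fun a r2 == +oo)%E
             then [set z | sqnorm z < r2]
             else [set z | sqnorm z <= r2]
  | _ => setT
  end.

End Euclidean.

Arguments natural_domain {R} d a.

(* The elements are functions on the natural maximal domain, holomorphic on
   the open ball and continuous up to the part of the boundary that belongs
   to the domain. Since the scalars are complex, "differentiable" means
   complex differentiable. *)
Record weighted_hardy_space (R : realType) (d : nat) := WeightedHardySpace {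
  whs_coef : nat -> R ;
  whs_generating : generating_function whs_coef ;
  whs_space :> hilbert_function_space R (natural_domain d whs_coef) ;
  whs_holomorphic : forall f : whs_space,
    exists F : 'rV[R[i]^o]_d -> R[i]^o,
      [/\ forall x, hfs_eval whs_space f x = F (val x),
          forall z, ((sqnorm z)%:E < conv_radius whs_coef)%E ->
            differentiable F z &
          {within natural_domain d whs_coef, continuous F}] ;
  whs_mono : {ffun 'I_d -> nat} -> whs_space ;
  whs_monoE : forall alpha x,
    hfs_eval whs_space (whs_mono alpha) x = mono_fun alpha (val x) ;
  whs_mono_neq0 : forall alpha, whs_mono alpha != 0 ;
  whs_mono_orthogonal : forall alpha beta : {ffun 'I_d -> nat}, alpha != beta ->
    hfs_dot whs_space (whs_mono alpha) (whs_mono beta) = 0 ;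
  whs_mono_complete : forall f : whs_space,
    (forall alpha, hfs_dot whs_space f (whs_mono alpha) = 0) -> f = 0 ;
  whs_mono_norm : forall alpha beta, mono_deg alpha = mono_deg beta ->
    `|whs_mono alpha| ^+ 2 / (mono_fact alpha)%:R =
    `|whs_mono beta| ^+ 2 / (mono_fact beta)%:R ;
  whs_norm1 : `|whs_mono [ffun=> 0%N]| = 1 ;
  whs_coefE : forall alpha,
    `|whs_mono alpha| ^- 2 =
    (whs_coef (mono_deg alpha))%:C *
      ((mono_deg alpha)`!%:R / (mono_fact alpha)%:R) }.

(* Main.v *)
Require Import Defs.
From HB Require Import structures.
From mathcomp Require Import all_boot all_order all_algebra.
From mathcomp Require Import complex.
From mathcomp Require Import all_classical all_reals all_analysis.
From mathcomp Require Import ring lra zify.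

Set Implicit Arguments.
Unset Strict Implicit.
Unset Printing Implicit Defensive.

Import Order.TTheory GRing.Theory Num.Theory.
Import numFieldNormedType.Exports.

Local Open Scope classical_set_scope.
Local Open Scope ring_scope.
Local Open Scope complex_scope.

(** Everything is decided on a single complex line. Write f_k for the
coefficient of z_i^k in f; these are the Taylor coefficients at 0 of the
restriction of f to the i-th axis, so that the first two of them obey the
Leibniz rule (fg)_0 = f_0 g_0 and (fg)_1 = f_0 g_1 + f_1 g_0
([axis_coef_mul]). The theorem then rests on a dichotomy: either z_i is a
multiplier, or every multiplier phi has phi_1 = 0.

The dichotomy ([coordinate_multiplier_of_linear_term]). If phi is a
multiplier, then f |-> (phi f)_(n+1) ||z_i^(n+1)|| is, for each n, a bounded
functional, and for fixed f its values are at most ||phi f||. By the uniform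
boundedness principle these functionals are bounded by a common C, and at
f = z_i^n this reads |phi_1| ||z_i^(n+1)|| <= C ||z_i^n||. If phi_1 <> 0, the
ratios a_n / a_(n+1) are therefore bounded. Since
||z_i z^alpha||^2 <= (a_n / a_(n+1)) ||z^alpha||^2 for |alpha| = n and the
monomials z_i z^alpha are orthogonal, the series of z_i f converges in the
space, and z_i is a multiplier.

The four conditions. If all z_i are multipliers, so are all polynomials, and
these are dense; then 1 is a cyclic vector. If c is cyclic and every
multiplier had phi_1 = 0, the Leibniz rule would give c_0 g_1 = c_1 g_0 for
all g in Mult c, hence for all g, which is absurd ([cyclic_linear_term]). If
every multiplier had phi_1 = 0, the functional f |-> f_0 + f_1 would be
partially multiplicative; it takes the value 1 at z_i and 0 at z_i^2, so it
is not multiplicative ([consistent_linear_term]). Both times the dichotomy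
shows that z_i is a multiplier.

Finally let all z_i be multipliers and rho partially multiplicative, and put
lambda_i = rho z_i. Then rho z^alpha = lambda^alpha. Testing the bound of rho
on the truncations of the would-be kernel function at lambda, and summing
with the multinomial formula, bounds the partial sums of G(|lambda|^2), so
that lambda lies in the natural domain. There rho and the evaluation at
lambda agree on polynomials, hence everywhere, and evaluations are
multiplicative ([functional_is_evaluation]). *)

(** * Norms over the complex numbers with values in the reals *)

(** The norm of a normed space over R[i] is itself an element of R[i], where
order is partial and suprema are missing; estimates and limits are carried
out on its real part. *)
Definition rnorm (R : realType) (V : normedZmodType R[i]) (v : V) : R :=
  complex.Re `|v|.

Section RealNorm.
Variables (R : realType).

Section Zmod.
Variable V : normedZmodType R[i].
Implicit Types u v w : V.

Lemma rnormE v : `|v| = (rnorm v)%:C.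
Proof. by rewrite RRe_real ?normr_real. Qed.

Lemma rnorm_ge0 v : 0 <= rnorm v.
Proof. by rewrite -ler0c -rnormE. Qed.

Lemma rnorm0 : rnorm (0 : V) = 0.
Proof. by rewrite /rnorm normr0. Qed.

Lemma rnorm_eq0 v : (rnorm v == 0) = (v == 0).
Proof. by rewrite -(normr_eq0 v) rnormE (inj_eq (@complexI _) _ 0). Qed.

Lemma rnorm_gt0 v : (0 < rnorm v) = (v != 0).
Proof. by rewrite lt_neqAle rnorm_ge0 andbT eq_sym rnorm_eq0. Qed.

Lemma rnormN v : rnorm (- v) = rnorm v.
Proof. by rewrite /rnorm normrN. Qed.

Lemma rnormBC u v : rnorm (u - v) = rnorm (v - u).
Proof. by rewrite /rnorm distrC. Qed.

Lemma rnormD u v : rnorm (u + v) <= rnorm u + rnorm v.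
Proof. by rewrite -lecR rmorphD /= -!rnormE ler_normD. Qed.

Lemma rnormB u v : rnorm (u - v) <= rnorm u + rnorm v.
Proof. by rewrite -(rnormN v) rnormD. Qed.

Lemma rnorm_triangle w u v : rnorm (u - v) <= rnorm (u - w) + rnorm (w - v).
Proof. by apply: le_trans (rnormD _ _); rewrite addrA subrK. Qed.

Lemma rnorm_sum (I : Type) (s : seq I) (P : pred I) (F : I -> V) :
  rnorm (\sum_(i <- s | P i) F i) <= \sum_(i <- s | P i) rnorm (F i).
Proof.
elim/big_rec2: _ => [|i x y _ h]; first by rewrite rnorm0.
by apply: le_trans (rnormD _ _) _; rewrite lerD2l.
Qed.

Lemma rnorm_eq0_small v : (forall e : R, 0 < e -> rnorm v <= e) -> v = 0.
Proof.
move=> h; apply/eqP; rewrite -rnorm_eq0 eq_le rnorm_ge0 andbT.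
by apply/ler_addgt0Pl => e e0; rewrite addr0 h.
Qed.

End Zmod.

Lemma rnormM (a b : R[i]) : rnorm (a * b) = rnorm a * rnorm b.
Proof. by apply: complexI; rewrite rmorphM /= -!rnormE normrM. Qed.

Lemma rnorm1 : rnorm (1 : R[i]) = 1.
Proof. by apply: complexI; rewrite -rnormE normr1. Qed.

Lemma rnormX (a : R[i]) n : rnorm (a ^+ n) = rnorm a ^+ n.
Proof. by apply: complexI; rewrite rmorphXn /= -!rnormE normrX. Qed.

Lemma rnormZ (V : normedModType R[i]) (a : R[i]) (v : V) :
  rnorm (a *: v) = rnorm a * rnorm v.
Proof. by apply: complexI; rewrite rmorphM /= -!rnormE normrZ. Qed.

Lemma rnorm_real (x : R) : rnorm x%:C = `|x|.
Proof.
apply: complexI; rewrite -rnormE normc_def /=.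
by rewrite expr0n addr0 sqrtr_sqr.
Qed.

Lemma normc_rnorm (z : R[i]) : Normc.normc z = rnorm z.
Proof. by rewrite /rnorm normc_def /=; case: z. Qed.

Section Convergence.
Variable V : normedModType R[i].

Lemma cvg_rnormP (u : nat -> V) (l : V) :
  u @ \oo --> l <->
  forall e : R, 0 < e -> exists N, forall n, (N <= n)%N -> rnorm (l - u n) < e.
Proof.
split=> [/cvgrPdist_lt h e e0|h].
  have /h : 0 < e%:C :> R[i] by rewrite ltcR.
  move=> [N _ hN]; exists N => n /hN /=.
  by rewrite rnormE ltcR.
apply/cvgrPdist_lt => e e0.
have eE : e = (complex.Re e)%:C by rewrite RRe_real // gtr0_real.
have [] := h (complex.Re e); first by rewrite -ltcR -eE.
by move=> N hN; exists N => // n /= /hN; rewrite rnormE eE ltcR.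
Qed.

Lemma le_cvg_rnorm (u : nat -> V) (l p : V) (B : R) :
  u @ \oo --> l -> (\forall n \near \oo, rnorm (u n - p) <= B) ->
  rnorm (l - p) <= B.
Proof.
move=> /cvg_rnormP h [N _ hN]; apply/ler_addgt0Pl => e e0.
have [N' hN'] := h e e0.
apply: le_trans (rnorm_triangle (u (maxn N N')) _ _) _.
apply: lerD; first by apply/ltW/hN'; rewrite leq_maxr.
by apply: hN; rewrite /= leq_maxl.
Qed.

End Convergence.

Lemma complete_rnorm (V : completeNormedModType R[i]) (u : nat -> V) :
  (forall e : R, 0 < e -> exists N, forall n, (N <= n)%N ->
     rnorm (u n - u N) < e) ->
  exists l : V, u @ \oo --> l.
Proof.
move=> h; suff : cvg (u @ \oo) by move=> cu; exists (lim (u @ \oo)).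
suff : cauchy_ex (u @ \oo) by move=> cu; apply: cauchy_cvg; exact: cauchy_exP.
move=> e e0.
have eE : e = (complex.Re e)%:C by rewrite RRe_real // gtr0_real.
have [] := h (complex.Re e); first by rewrite -ltcR -eE.
move=> N hN; exists (u N); exists N => // n /= /hN.
by rewrite -ball_normE /ball_ /= distrC rnormE eE ltcR.
Qed.

End RealNorm.

(** * The uniform boundedness principle *)

Section UniformBoundedness.
Variables (R : realType) (V : completeNormedModType R[i]).
Variable T : nat -> V -> R[i].
Hypothesis linT : forall n a u v, T n (a *: u + v) = a * T n u + T n v.

Let TB n u v : T n (u - v) = T n u - T n v.
Proof. by rewrite addrC -scaleN1r linT mulN1r addrC. Qed.

(** A bound on a ball of any centre is a bound at the origin, since v is up to
scaling the difference of two points of the ball. *)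
Lemma bounded_on_ball (x : V) (r k : R) : 0 < r ->
  (forall n y, rnorm (y - x) <= r -> rnorm (T n y) <= k) ->
  exists M, forall n v, rnorm (T n v) <= M * rnorm v.
Proof.
move=> r0 h; exists (2 * k / r) => n v.
have [->|v0] := eqVneq v 0.
  by have := TB n 0 0; rewrite !subrr => ->; rewrite !rnorm0 mulr0.
have nv0 : 0 < rnorm v by rewrite rnorm_gt0.
pose c := r / rnorm v.
have c0 : 0 < c by rewrite divr_gt0.
have h1 : rnorm (c%:C * T n v) <= 2 * k.
  have -> : c%:C * T n v = T n (c%:C *: v + x) - T n x by rewrite linT addrK.
  apply: le_trans (rnormB _ _) _; rewrite mulr2n mulrDl mul1r lerD // h //.
    by rewrite addrK rnormZ rnorm_real gtr0_norm // divfK ?gt_eqF.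
  by rewrite subrr rnorm0 ltW.
rewrite rnormM rnorm_real gtr0_norm // in h1.
have -> : rnorm (T n v) = (c * rnorm (T n v)) / c by rewrite mulrC mulKf ?gt_eqF.
apply: le_trans (_ : 2 * k / c <= _); first by rewrite ler_pM2r ?invr_gt0.
by rewrite /c invf_div mulrA mulrAC.
Qed.

(** Baire's argument with explicit balls. If no uniform bound existed, then no
ball would carry one, so inside any ball there is a point, and by continuity
a smaller ball, on which some T n exceeds a given k. The common point of such
nested balls for k = 0, 1, 2, ... contradicts pointwise boundedness. *)
Theorem uniform_boundedness :
  (forall n, exists M, forall v, rnorm (T n v) <= M * rnorm v) ->
  (forall v, exists M, forall n, rnorm (T n v) <= M) ->
  exists M, forall n v, rnorm (T n v) <= M * rnorm v.
Proof.
move=> bT pT; apply: contrapT => nM.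
have step (kb : nat * (V * {posnum R})) : exists b' : V * {posnum R},
    b'.2%:num <= kb.2.2%:num / 2 /\
    forall z, rnorm (z - b'.1) <= b'.2%:num -> rnorm (z - kb.2.1) <= kb.2.2%:num
      /\ exists n, kb.1%:R < rnorm (T n z).
  case: kb => k [x r] /=.
  have [n [y [yx ky]]] : exists n y, rnorm (y - x) <= r%:num / 2 /\
      k%:R < rnorm (T n y).
    apply: contrapT => h; apply: nM.
    apply: (@bounded_on_ball x (r%:num / 2) k%:R) => // n y yx.
    by rewrite leNgt; apply/negP => ky; apply: h; exists n, y.
  have [M hM] := bT n.
  pose M' := `|M| + 1.
  have M'0 : 0 < M' by rewrite ltr_pwDr.
  have hM' v : rnorm (T n v) <= M' * rnorm v.
    apply: le_trans (hM v) _; rewrite ler_wpM2r ?rnorm_ge0 //.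
    by rewrite (le_trans (ler_norm _)) // lerDl.
  (* Within e of y, the value of T n changes by at most half its excess over k. *)
  pose e := (rnorm (T n y) - k%:R) / (2 * M').
  have e0 : 0 < e by rewrite divr_gt0 ?subr_gt0 // mulr_gt0.
  have m0 : 0 < Num.min (r%:num / 2) e by rewrite lt_min e0 divr_gt0.
  exists (y, PosNum m0) => /=; split; first by rewrite ge_min lexx.
  move=> z; rewrite le_min => /andP[z1 z2]; split.
    apply: le_trans (rnorm_triangle y _ _) _.
    by rewrite [leRHS]splitr lerD.
  exists n; have := rnormD (T n (y - z)) (T n z).
  have := hM' (y - z); rewrite rnormBC.
  have : M' * rnorm (z - y) <= (rnorm (T n y) - k%:R) / 2.
    have -> : (rnorm (T n y) - k%:R) / 2 = M' * e.
      by rewrite /e; field; rewrite gt_eqF.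
    by rewrite ler_pM2l.
  rewrite TB subrK; lra.
have [g hg] := choice step.
pose fix b n := if n is m.+1 then g (m, b m) else (0, PosNum ltr01) : V * {posnum R}.
have bS n : b n.+1 = g (n, b n) by [].
have rad n : (b n).2%:num <= (2 ^+ n)^-1.
  elim: n => [|n ih]; first by rewrite expr0 invr1.
  rewrite bS; have [+ _] := hg (n, b n); move=> /le_trans; apply.
  by rewrite exprSr invfM ler_pM2r.
have nest n m z : rnorm (z - (b (n + m)%N).1) <= (b (n + m)%N).2%:num ->
    rnorm (z - (b n).1) <= (b n).2%:num.
  elim: m => [|m ih]; rewrite ?addn0 // addnS bS => hz; apply: ih.
  by have [_ /(_ z hz) []] := hg ((n + m)%N, b (n + m)%N).
have center n m : rnorm ((b (n + m)%N).1 - (b n).1) <= (b n).2%:num.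
  by apply: (nest n m); rewrite subrr rnorm0.
have [l hl] : exists l : V, (fun n => (b n).1) @ \oo --> l.
  apply: complete_rnorm => e e0.
  have [N hN] : exists N : nat, (2 ^+ N)^-1 < e.
    exists (Num.truncn e^-1); rewrite -[ltRHS]invrK ltf_pV2 ?posrE ?invr_gt0 ?exprn_gt0 //.
    apply: lt_le_trans (truncnS_gt _) _.
    by rewrite -natrX ler_nat ltn_expl.
  exists N => n Nn; apply: le_lt_trans hN; apply: le_trans (rad N).
  by rewrite -(subnKC Nn).
have lin n : rnorm (l - (b n).1) <= (b n).2%:num.
  apply: (le_cvg_rnorm hl); exists n => // m /= nm.
  by rewrite -(subnKC nm).
have [M hM] := pT l.
pose N := (Num.truncn M).+1.
have [_ /(_ l (lin N.+1))[_ [n]]] := hg (N, b N).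
apply/negP; rewrite -leNgt; apply: le_trans (hM n) _.
by rewrite ltW // truncnS_gt.
Qed.

End UniformBoundedness.

(** * Orthogonal series in Hilbert spaces *)

Section Orthogonality.
Variables (R : realType) (V : completeNormedModType R[i]).
Variables (dot : {dot V for Num.conj}).
Hypothesis normE : forall f : V, `|f| ^+ 2 = dot f f.

Lemma dot_rnorm v : dot v v = (rnorm v ^+ 2)%:C.
Proof. by rewrite -normE rnormE rmorphXn. Qed.

Lemma pythagoras u v : dot u v = 0 ->
  rnorm (u + v) ^+ 2 = rnorm u ^+ 2 + rnorm v ^+ 2.
Proof.
move=> uv; apply: complexI; rewrite rmorphD /= -!dot_rnorm.
by rewrite dnormD uv conjC0 !addr0.
Qed.

Lemma cauchy_schwarz u v : rnorm (dot u v) <= rnorm u * rnorm v.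
Proof.
have [->|v0] := eqVneq v 0; first by rewrite linear0r !rnorm0 mulr0.
have nv0 : 0 < rnorm v by rewrite rnorm_gt0.
pose c := dot u v / dot v v.
have dv0 : dot v v != 0 by rewrite dnorm_eq0.
have ort : dot (u - c *: v) (c *: v) = 0.
  by rewrite linearZr_LR linearBl linearZl_LR /= divfK // subrr mulr0.
have := pythagoras ort; rewrite subrK => h.
have {h} : rnorm (c *: v) <= rnorm u.
  by rewrite -(@ler_pXn2r _ 2) ?nnegrE ?rnorm_ge0 // h lerDr sqr_ge0.
rewrite rnormZ -(ler_pM2r nv0); apply: le_trans.
rewrite -mulrA -expr2 /c.
have -> : dot u v / dot v v = dot u v * ((rnorm v ^+ 2)^-1)%:C.
  by rewrite dot_rnorm fmorphV.
by rewrite rnormM rnorm_real ger0_norm ?invr_ge0 ?sqr_ge0 // divfK // gt_eqF // exprn_gt0.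
Qed.

Lemma rnorm_sum_orthogonal (I : eqType) (s : seq I) (w : I -> V) : uniq s ->
  (forall i j, i != j -> dot (w i) (w j) = 0) ->
  rnorm (\sum_(i <- s) w i) ^+ 2 = \sum_(i <- s) rnorm (w i) ^+ 2.
Proof.
move=> + ow; elim: s => [|i s ih] /=; first by rewrite !big_nil rnorm0 expr0n.
move=> /andP[iNs us]; rewrite !big_cons pythagoras ?ih //.
rewrite linear_sumr big_seq big1 // => j js; apply: ow.
by apply: contraNneq iNs => ->.
Qed.

Lemma orthogonal_series_cvg (w : nat -> V) (B : R) :
  (forall i j, i != j -> dot (w i) (w j) = 0) ->
  (forall N, rnorm (\sum_(k < N) w k) ^+ 2 <= B) ->
  exists l : V, (fun N => \sum_(k < N) w k) @ \oo --> l.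
Proof.
move=> ow hB; apply: complete_rnorm => e e0.
(* The squared distance of two partial sums is a difference of two values of
   the nondecreasing bounded sequence s, so closeness to its supremum gives the
   Cauchy property. *)
pose s N := \sum_(k < N) rnorm (w k) ^+ 2.
have sE N : s N = rnorm (\sum_(k < N) w k) ^+ 2.
  rewrite /s -(big_mkord xpredT (fun k => rnorm (w k) ^+ 2)).
  by rewrite -(big_mkord xpredT w) rnorm_sum_orthogonal // iota_uniq.
have hs : has_sup (range s).
  split; first by exists (s 0%N), 0%N.
  by exists B => _ [N _ <-]; rewrite sE.
have [_ [N _ <-] hN] := sup_adherent (exprn_gt0 2 e0) hs.
exists N => n Nn; rewrite -(@ltr_pXn2r _ 2) ?nnegrE ?rnorm_ge0 ?(ltW e0) //.
have -> : \sum_(k < n) w k - \sum_(k < N) w k = \sum_(N <= k < n) w k.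
  by rewrite -!(big_mkord xpredT w) (big_cat_nat _ Nn) //= addrAC subrr add0r.
rewrite rnorm_sum_orthogonal ?iota_uniq //.
have : s n <= sup (range s) by apply: sup_upper_bound => //; exists n.
rewrite /s -!(big_mkord xpredT (fun k => rnorm (w k) ^+ 2)).
move: hN; rewrite /s -!(big_mkord xpredT (fun k => rnorm (w k) ^+ 2)).
rewrite (big_cat_nat _ Nn) //=; lra.
Qed.

End Orthogonality.

(** * Multi-indices and the multinomial formula *)

Section MultiIndices.
Variable d : nat.
Implicit Types (i : 'I_d) (alpha beta : {ffun 'I_d -> nat}).

(** Multi-indices form an infinite type; those of degree n are listed through
their values in 'I_n.+1, which is possible as no entry exceeds the degree. *)
Definition indices_of_degree (n : nat) : seq {ffun 'I_d -> nat} :=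
  [seq [ffun i => nat_of_ord (b i)] | b : {ffun 'I_d -> 'I_n.+1}
     <- enum {ffun 'I_d -> 'I_n.+1} & (\sum_(i < d) b i == n)%N].

Definition indices_below (N : nat) : seq {ffun 'I_d -> nat} :=
  flatten [seq indices_of_degree n | n <- iota 0 N].

Definition shift_index i alpha : {ffun 'I_d -> nat} :=
  [ffun j => (alpha j + (j == i))%N].

Definition axis_index i (k : nat) : {ffun 'I_d -> nat} :=
  [ffun j => if j == i then k else 0%N].

Lemma le_mono_deg i alpha : (alpha i <= mono_deg alpha)%N.
Proof. by rewrite /mono_deg (bigD1 i) //= leq_addr. Qed.

Lemma mem_indices_of_degree n alpha :
  (alpha \in indices_of_degree n) = (mono_deg alpha == n).
Proof.
apply/mapP/eqP => [[b]|an].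
  rewrite mem_filter => /andP[/eqP bn _] ->; rewrite -[RHS]bn.
  by apply: eq_bigr => i _; rewrite ffunE.
have lt i : (alpha i < n.+1)%N by rewrite ltnS -an le_mono_deg.
exists [ffun i => Ordinal (lt i)]; last by apply/ffunP => i; rewrite !ffunE.
rewrite mem_filter mem_enum andbT -[X in _ == X]an.
by apply/eqP; apply: eq_bigr => i _; rewrite ffunE.
Qed.

Lemma uniq_indices_of_degree n : uniq (indices_of_degree n).
Proof.
rewrite map_inj_in_uniq; first by rewrite filter_uniq // enum_uniq.
move=> b c _ _ /ffunP h.
by apply/ffunP => i; apply/val_inj; have := h i; rewrite !ffunE.
Qed.

Lemma mem_indices_below N alpha :
  (alpha \in indices_below N) = (mono_deg alpha < N)%N.
Proof.
apply/flatten_mapP/idP => [[n]|aN].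
  by rewrite mem_iota mem_indices_of_degree => /andP[_ nN] /eqP ->.
by exists (mono_deg alpha); rewrite ?mem_iota // mem_indices_of_degree.
Qed.

Lemma big_indices_below (A : Type) (idx : A) (op : Monoid.law idx) N
    (F : {ffun 'I_d -> nat} -> A) :
  \big[op/idx]_(alpha <- indices_below N) F alpha =
  \big[op/idx]_(n < N) \big[op/idx]_(alpha <- indices_of_degree n) F alpha.
Proof.
rewrite big_flatten big_map -(big_mkord xpredT
  (fun n => \big[op/idx]_(alpha <- indices_of_degree n) F alpha)).
by rewrite /index_iota subn0.
Qed.

Lemma uniq_indices_below N : uniq (indices_below N).
Proof.
elim: N => // N ih; rewrite /indices_below -addn1 iotaD map_cat flatten_cat.
rewrite cat_uniq ih /= cats0 uniq_indices_of_degree andbT; apply/hasPn => a.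
by rewrite mem_indices_of_degree mem_indices_below => /eqP ->; rewrite ltnn.
Qed.

Lemma mono_deg_shift i alpha :
  mono_deg (shift_index i alpha) = (mono_deg alpha).+1.
Proof.
rewrite /mono_deg -addn1; under eq_bigr do rewrite ffunE.
rewrite big_split /=; congr addn.
by rewrite (bigD1 i) //= eqxx big1 ?addn0 // => j /negPf ->.
Qed.

Lemma mono_fact_shift i alpha :
  mono_fact (shift_index i alpha) = ((alpha i).+1 * mono_fact alpha)%N.
Proof.
rewrite /mono_fact (bigD1 i) //= [in RHS](bigD1 i) //= ffunE eqxx addn1 factS.
rewrite mulnA; congr (_ * _)%N; apply: eq_bigr => j /negPf ji.
by rewrite ffunE ji addn0.
Qed.

Lemma shift_index_inj i : injective (shift_index i).
Proof.
move=> a b /ffunP h; apply/ffunP => j; have := h j.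
by rewrite !ffunE; apply: addIn.
Qed.

Lemma axis_index0 i : axis_index i 0 = [ffun=> 0%N].
Proof. by apply/ffunP => j; rewrite !ffunE if_same. Qed.

Lemma axis_indexS i k : axis_index i k.+1 = shift_index i (axis_index i k).
Proof.
by apply/ffunP => j; rewrite !ffunE; case: eqP => _; rewrite ?addn1 ?addn0.
Qed.

Lemma mono_deg0 : mono_deg ([ffun=> 0%N] : {ffun 'I_d -> nat}) = 0%N.
Proof. by rewrite /mono_deg big1 // => i _; rewrite ffunE. Qed.

Lemma mono_fact0 : mono_fact ([ffun=> 0%N] : {ffun 'I_d -> nat}) = 1%N.
Proof. by rewrite /mono_fact big1 // => i _; rewrite ffunE fact0. Qed.

Lemma mono_deg_axis i k : mono_deg (axis_index i k) = k.
Proof.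
elim: k => [|k ih]; first by rewrite axis_index0 mono_deg0.
by rewrite axis_indexS mono_deg_shift ih.
Qed.

Lemma mono_fact_axis i k : mono_fact (axis_index i k) = k`!.
Proof.
elim: k => [|k ih]; first by rewrite axis_index0 mono_fact0.
by rewrite axis_indexS mono_fact_shift ih ffunE eqxx factS.
Qed.

Lemma axis_index_eq i k l : (axis_index i k == axis_index i l) = (k == l).
Proof.
apply/eqP/eqP => [/(congr1 (@mono_deg d))|-> //].
by rewrite !mono_deg_axis.
Qed.

Lemma perm_shift_index i n :
  perm_eq [seq alpha : {ffun 'I_d -> nat} <- indices_of_degree n.+1 | (0 < alpha i)%N]
          (map (shift_index i) (indices_of_degree n)).
Proof.
apply: uniq_perm; first by rewrite filter_uniq ?uniq_indices_of_degree.
  by rewrite map_inj_uniq ?uniq_indices_of_degree //; exact: shift_index_inj.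
move=> alpha; rewrite mem_filter mem_indices_of_degree.
apply/andP/mapP => [[ai /eqP an]|[beta]]; last first.
  rewrite mem_indices_of_degree => /eqP <- ->.
  by rewrite mono_deg_shift ffunE eqxx addn1.
have aE : alpha = shift_index i [ffun j => (alpha j - (j == i))%N].
  apply/ffunP => j; rewrite !ffunE subnK //.
  by case: eqP => // ->.
exists [ffun j => (alpha j - (j == i))%N] => //.
by rewrite mem_indices_of_degree -eqSS -(mono_deg_shift i) -aE an.
Qed.

(** The function mono_fun over an arbitrary ring: the multinomial formula needs
it at the real numbers |lambda_i|^2. *)
Definition monomial (K : comNzRingType) (x : 'I_d -> K) alpha : K :=
  \prod_(i < d) x i ^+ alpha i.

Lemma monomial_shift (K : comNzRingType) (x : 'I_d -> K) i alpha :
  monomial x (shift_index i alpha) = x i * monomial x alpha.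
Proof.
rewrite /monomial (bigD1 i) //= [in RHS](bigD1 i) //= ffunE eqxx addn1 exprS.
rewrite mulrA; congr (_ * _); apply: eq_bigr => j /negPf ji.
by rewrite ffunE ji addn0.
Qed.

Lemma monomial0 (K : comNzRingType) (x : 'I_d -> K) :
  monomial x [ffun=> 0%N] = 1.
Proof. by rewrite /monomial big1 // => i _; rewrite ffunE expr0. Qed.

Lemma multi_index_ind (P : {ffun 'I_d -> nat} -> Prop) :
  P [ffun=> 0%N] -> (forall i beta, P beta -> P (shift_index i beta)) ->
  forall alpha, P alpha.
Proof.
move=> P0 PS alpha.
have [n] : {n | mono_deg alpha = n} by exists (mono_deg alpha).
elim: n alpha => [|n ih] alpha an.
  suff -> : alpha = [ffun=> 0%N] by [].
  by apply/ffunP => i; apply/eqP; rewrite ffunE -leqn0 -an le_mono_deg.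
have [i ai] : exists i, alpha i != 0%N.
  apply: contrapT => na; move: an; rewrite /mono_deg big1 // => i _.
  by apply/eqP/negPn/negP => ai; apply: na; exists i.
have aE : alpha = shift_index i [ffun j => (alpha j - (j == i))%N].
  apply/ffunP => j; rewrite !ffunE subnK //.
  by case: eqP => // ->; rewrite lt0n.
rewrite aE; apply/PS/ih/succn_inj.
by rewrite -(mono_deg_shift i) -aE.
Qed.

Lemma indices_of_degree0 : indices_of_degree 0 = [:: [ffun=> 0%N]].
Proof.
apply: perm_small_eq => //; apply: uniq_perm => //.
  exact: uniq_indices_of_degree.
move=> a; rewrite mem_indices_of_degree inE; apply/eqP/eqP => [a0|->].
  apply/ffunP => i; rewrite ffunE; apply/eqP.
  by rewrite -leqn0 -a0 le_mono_deg.
exact: mono_deg0.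
Qed.

(** Induction on n. Weighting the term of alpha by alpha_i and summing over i
multiplies it by its degree n + 1; on the other hand the terms with
alpha_i > 0 are the shifts by i of the terms of degree n, and the weight turns
them into (n + 1) x_i times the latter. *)
Theorem multinomial_formula (K : numFieldType) (x : 'I_d -> K) n :
  \sum_(alpha <- indices_of_degree n)
     n`!%:R / (mono_fact alpha)%:R * monomial x alpha = (\sum_i x i) ^+ n.
Proof.
elim: n => [|n ih].
  by rewrite indices_of_degree0 big_seq1 mono_fact0 monomial0 fact0 expr0 divr1 mulr1.
have n0 : n.+1%:R != 0 :> K by rewrite pnatr_eq0.
apply: (mulfI n0); rewrite exprS -ih mulr_suml !mulr_sumr.
transitivity (\sum_(alpha <- indices_of_degree n.+1) \sum_i (alpha i)%:R *
   (n.+1`!%:R / (mono_fact alpha)%:R * monomial x alpha)).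
  apply: eq_big_seq => alpha; rewrite mem_indices_of_degree => /eqP an.
  by rewrite -mulr_suml -natr_sum -an.
rewrite exchange_big /=; apply: eq_bigr => i _.
rewrite (bigID (fun alpha : {ffun 'I_d -> nat} => (0 < alpha i)%N)) /=.
rewrite [X in _ + X]big1 ?addr0; last first.
  by move=> alpha; rewrite -eqn0Ngt => /eqP ->; rewrite mul0r.
rewrite -big_filter (perm_big _ (perm_shift_index i n)) big_map /=.
rewrite !mulr_sumr; apply: eq_bigr => beta _.
rewrite monomial_shift mono_fact_shift ffunE eqxx addn1 factS !natrM.
have f0 : (mono_fact beta)%:R != 0 :> K.
  by rewrite pnatr_eq0 -lt0n prodn_gt0 // => j; rewrite fact_gt0.
have b0 : (beta i).+1%:R != 0 :> K by rewrite pnatr_eq0.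
move: (n.+1)%:R (n`!)%:R (mono_fact beta)%:R (beta i).+1%:R f0 b0 => a b c e c0 e0.
by field; rewrite c0 e0.
Qed.

End MultiIndices.

(** * Bounded functionals *)

Section BoundedFunctionals.
Variables (R : realType) (V : normedModType R[i]).

Lemma bounded_functional_rnorm (rho : V -> R[i]) : bounded_functional rho ->
  exists2 M : R, 0 <= M & forall f, rnorm (rho f) <= M * rnorm f.
Proof.
move=> [M hM]; exists `|complex.Re M| => // f.
have := hM f; rewrite !rnormE lecE => /andP[_] /=.
have -> : complex.Re (M * (rnorm f)%:C) = complex.Re M * rnorm f.
  by case: M {hM} => a b /=; rewrite mulr0 subr0.
move=> /le_trans; apply; rewrite ler_wpM2r ?rnorm_ge0 //; exact: ler_norm.
Qed.

Lemma rnorm_bounded_functional (rho : V -> R[i]) (M : R) :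
  (forall f, rnorm (rho f) <= M * rnorm f) -> bounded_functional rho.
Proof.
by move=> hM; exists M%:C => f; rewrite !rnormE -rmorphM /= lecR.
Qed.

Lemma cvg_bounded_functional (rho : V -> R[i]) (u : nat -> V) (l : V) :
  (forall f g, rho (f - g) = rho f - rho g) -> bounded_functional rho ->
  u @ \oo --> l -> (fun n => rho (u n) : R[i]^o) @ \oo --> (rho l : R[i]^o).
Proof.
move=> rhoB /bounded_functional_rnorm[M M0 hM] /cvg_rnormP ul.
apply/cvg_rnormP => e e0.
have M1 : 0 < M + 1 by rewrite ltr_wpDl.
have [N hN] := ul _ (divr_gt0 e0 M1).
exists N => n /hN h; rewrite -rhoB; apply: le_lt_trans (hM _) _.
apply: le_lt_trans (_ : (M + 1) * rnorm (l - u n) < e).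
  by rewrite ler_wpM2r ?rnorm_ge0 // lerDl.
by rewrite mulrC -ltr_pdivlMr.
Qed.

Lemma bounded_functional_eq_closure (rho sigma : V -> R[i]) (A : set V) f :
  (forall f g, rho (f - g) = rho f - rho g) -> bounded_functional rho ->
  (forall f g, sigma (f - g) = sigma f - sigma g) -> bounded_functional sigma ->
  (forall g, A g -> rho g = sigma g) -> closure A f -> rho f = sigma f.
Proof.
move=> rB /bounded_functional_rnorm[M M0 hM] sB.
move=> /bounded_functional_rnorm[M' M0' hM'] eqA clf.
apply/eqP; rewrite -subr_eq0; apply/eqP; apply: rnorm_eq0_small => e e0.
have MM : 0 < M + M' + 1 by rewrite ltr_wpDl // addr_ge0.
have dpos : 0 < (e / (M + M' + 1))%:C :> R[i] by rewrite ltcR divr_gt0.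
have [g [Ag]] := clf _ (nbhsx_ballx f _ dpos).
rewrite -ball_normE /ball_ /= rnormE ltcR => fg.
have -> : rho f - sigma f = rho (f - g) - sigma (f - g).
  by rewrite rB sB (eqA g Ag) opprB addrA subrK.
apply: le_trans (rnormB _ _) _.
apply: le_trans (lerD (hM _) (hM' _)) _; rewrite -mulrDl.
apply: le_trans (_ : (M + M' + 1) * rnorm (f - g) <= e).
  by rewrite ler_wpM2r ?rnorm_ge0 // lerDl.
by rewrite mulrC -ler_pdivlMr // ltW.
Qed.

End BoundedFunctionals.

(** * Monomial expansions in a weighted Hardy space *)

Section Expansion.
Variables (R : realType) (d : nat) (H : weighted_hardy_space R d).

Local Notation a := (whs_coef H).
Local Notation X := (natural_domain d a).
Local Notation dot := (hfs_dot H).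
Local Notation ev := (hfs_eval H).
Local Notation e := (whs_mono H).
Implicit Types (f g : H) (alpha beta : {ffun 'I_d -> nat}).

Lemma evD f g x : ev (f + g) x = ev f x + ev g x.
Proof. by rewrite linearD. Qed.

Lemma evB f g x : ev (f - g) x = ev f x - ev g x.
Proof. by rewrite linearB. Qed.

Lemma evZ (c : R[i]) f x : ev (c *: f) x = c * ev f x.
Proof. by rewrite linearZ. Qed.

Lemma ev_sum (I : Type) (s : seq I) (F : I -> H) x :
  ev (\sum_(i <- s) F i) x = \sum_(i <- s) ev (F i) x.
Proof.
elim/big_rec2: _ => [|i u v _ <-]; first by rewrite linear0.
by rewrite evD.
Qed.

Lemma ev_bounded x : bounded_functional (fun f : H => ev f x).
Proof. exact: hfs_eval_bounded. Qed.

Lemma ev_mono alpha (x : X) : ev (e alpha) x = monomial ((val x) ord0) alpha.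
Proof. exact: whs_monoE. Qed.

Lemma dot_mono_neq0 alpha : dot (e alpha) (e alpha) != 0.
Proof. by rewrite dnorm_eq0 whs_mono_neq0. Qed.

Lemma rnorm_mono_gt0 alpha : 0 < rnorm (e alpha).
Proof. by rewrite rnorm_gt0 whs_mono_neq0. Qed.

Lemma rnorm_mono alpha :
  rnorm (e alpha) ^+ 2 =
  (mono_fact alpha)%:R / (a (mono_deg alpha) * (mono_deg alpha)`!%:R).
Proof.
have := whs_coefE H alpha.
rewrite rnormE => /(congr1 GRing.inv); rewrite invrK => h.
apply: complexI; rewrite rmorphXn /= h; rewrite !(fmorphV, rmorphM) /= !rmorph_nat.
by rewrite !invfM !invrK mulrA mulrC mulrA mulrC.
Qed.

(** The ratio that decides whether z_i is a multiplier: its middle factor is at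
most 1, and equals 1 when z^alpha is a power of z_i. *)
Lemma rnorm_mono_shift i alpha :
  rnorm (e (shift_index i alpha)) ^+ 2 = rnorm (e alpha) ^+ 2 *
  ((alpha i).+1%:R / (mono_deg alpha).+1%:R) *
  (a (mono_deg alpha) / a (mono_deg alpha).+1).
Proof.
have [_ a0 _] := whs_generating H.
rewrite !rnorm_mono mono_deg_shift mono_fact_shift factS !natrM.
have f0 : (mono_deg alpha)`!%:R != 0 :> R by rewrite pnatr_eq0 -lt0n fact_gt0.
have n0 : (mono_deg alpha).+1%:R != 0 :> R by rewrite pnatr_eq0.
have := lt0r_neq0 (a0 (mono_deg alpha)); have := lt0r_neq0 (a0 (mono_deg alpha).+1).
move: (a _) (a _) (_.+1%:R) (_`!%:R) (_.+1%:R) (mono_fact _)%:R f0 n0.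
move=> x y z t u v t0 u0 y0 x0.
by field; rewrite ?x0 ?y0 ?t0 ?u0.
Qed.

(** As the monomials are orthogonal, the Fourier coefficients with respect to
them are the Taylor coefficients of f. *)
Definition mono_coef f alpha : R[i] := dot f (e alpha) / dot (e alpha) (e alpha).

Lemma mono_coefB f g alpha : mono_coef (f - g) alpha = mono_coef f alpha - mono_coef g alpha.
Proof. by rewrite /mono_coef linearBl mulrBl. Qed.

Lemma mono_coef_linear (c : R[i]) f g alpha :
  mono_coef (c *: f + g) alpha = c * mono_coef f alpha + mono_coef g alpha.
Proof. by rewrite /mono_coef linearPl mulrDl /= mulrA. Qed.

Lemma mono_coef_mono alpha beta : mono_coef (e alpha) beta = (alpha == beta)%:R.
Proof.
rewrite /mono_coef; have [->|ab] := eqVneq; first by rewrite divff ?dot_mono_neq0.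
by rewrite whs_mono_orthogonal // mul0r.
Qed.

Lemma rnorm_mono_coef f alpha : rnorm (mono_coef f alpha) * rnorm (e alpha) <= rnorm f.
Proof.
have e0 := rnorm_mono_gt0 alpha.
have -> : mono_coef f alpha = dot f (e alpha) * ((rnorm (e alpha) ^+ 2)^-1)%:C.
  by rewrite /mono_coef (dot_rnorm (@hfs_normE _ _ _) (e alpha)) fmorphV.
rewrite rnormM rnorm_real ger0_norm ?invr_ge0 ?sqr_ge0 // expr2 invfM mulrA.
rewrite divfK ?gt_eqF // ler_pdivrMr //.
exact: (cauchy_schwarz (@hfs_normE _ _ _)).
Qed.

Lemma mono_coef_bounded alpha : bounded_functional (mono_coef^~ alpha).
Proof.
apply: (@rnorm_bounded_functional _ _ _ (rnorm (e alpha))^-1) => f.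
by rewrite mulrC ler_pdivlMr ?rnorm_mono_gt0 // rnorm_mono_coef.
Qed.

Lemma orthogonal_family_cvg (v : {ffun 'I_d -> nat} -> H) (B : R) :
  (forall alpha beta, alpha != beta -> dot (v alpha) (v beta) = 0) ->
  (forall N, \sum_(alpha <- indices_below d N) rnorm (v alpha) ^+ 2 <= B) ->
  exists l : H, (fun N => \sum_(alpha <- indices_below d N) v alpha) @ \oo --> l.
Proof.
move=> ov hB.
pose w n := \sum_(alpha <- indices_of_degree d n) v alpha.
have sE N : \sum_(k < N) w k = \sum_(alpha <- indices_below d N) v alpha.
  by rewrite big_indices_below.
have [l hl] : exists l : H, (fun N => \sum_(k < N) w k) @ \oo --> l.
  apply: (@orthogonal_series_cvg _ _ dot (@hfs_normE _ _ _) w B) => [i j ij|N].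
    rewrite /w linear_sumlz big_seq big1 // => alpha; rewrite mem_indices_of_degree.
    move=> /eqP ai; rewrite linear_sumr big_seq big1 // => beta.
    rewrite mem_indices_of_degree => /eqP bj; apply: ov.
    by apply: contraNneq ij => ab; rewrite -ai -bj ab.
  rewrite sE (rnorm_sum_orthogonal (@hfs_normE _ _ _)) //.
  exact: uniq_indices_below.
exists l; under eq_fun do rewrite -sE.
exact: hl.
Qed.

Definition partial_sum N f : H :=
  \sum_(alpha <- indices_below d N) mono_coef f alpha *: e alpha.

Lemma ev_partial_sum N f (x : X) : ev (partial_sum N f) x =
  \sum_(alpha <- indices_below d N) mono_coef f alpha * monomial ((val x) ord0) alpha.
Proof. by rewrite ev_sum; apply: eq_bigr => i _; rewrite evZ ev_mono. Qed.

Lemma dot_scaled_mono (b c : R[i]) alpha beta : alpha != beta ->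
  dot (b *: e alpha) (c *: e beta) = 0.
Proof.
by move=> ab; rewrite linearZl_LR linearZr_LR /= whs_mono_orthogonal // !mulr0.
Qed.

Lemma mono_coef_partial_sum N f beta : (mono_deg beta < N)%N ->
  mono_coef (partial_sum N f) beta = mono_coef f beta.
Proof.
move=> bN; rewrite {1}/mono_coef /partial_sum linear_sumlz /=.
rewrite (bigD1_seq beta) ?mem_indices_below ?uniq_indices_below //=.
rewrite big1 ?addr0 => [|alpha ab]; last first.
  by rewrite linearZl_LR /= whs_mono_orthogonal // mulr0.
by rewrite linearZl_LR /= mulfK // dot_mono_neq0.
Qed.

Lemma bessel N f :
  \sum_(alpha <- indices_below d N) rnorm (mono_coef f alpha *: e alpha) ^+ 2 <=
  rnorm f ^+ 2.
Proof.
rewrite -(rnorm_sum_orthogonal (@hfs_normE _ _ _)) ?uniq_indices_below //; last first.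
  by move=> alpha beta; exact: dot_scaled_mono.
have ort : dot (f - partial_sum N f) (partial_sum N f) = 0.
  rewrite {2}/partial_sum linear_sumr big_seq big1 // => alpha.
  rewrite mem_indices_below => aN; rewrite linearZr_LR /=.
  apply/eqP; rewrite mulf_eq0; apply/orP; right.
  have := mono_coefB f (partial_sum N f) alpha; rewrite mono_coef_partial_sum // subrr.
  by move/eqP; rewrite mulf_eq0 invr_eq0 (negPf (dot_mono_neq0 _)) orbF.
have := pythagoras (@hfs_normE _ _ _) ort; rewrite subrK => ->.
by rewrite lerDr sqr_ge0.
Qed.

(** By Bessel's inequality the series converges to some g; f - g is orthogonal to
all monomials, hence zero by their completeness. *)
Theorem partial_sum_cvg f : (fun N => partial_sum N f) @ \oo --> f.
Proof.
have [g hg] : exists g : H, (fun N => partial_sum N f) @ \oo --> g.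
  apply: (@orthogonal_family_cvg _ (rnorm f ^+ 2)) => [alpha beta|N].
    exact: dot_scaled_mono.
  exact: bessel.
suff fg : f = g by move: hg; rewrite -fg.
apply/eqP; rewrite -subr_eq0; apply/eqP; apply: whs_mono_complete => alpha.
have /eqP : mono_coef f alpha - mono_coef g alpha = 0.
  apply/eqP; rewrite -rnorm_eq0 eq_le rnorm_ge0 andbT rnormBC.
  have := @cvg_bounded_functional _ _ (mono_coef^~ alpha) _ _ (fun f g => mono_coefB f g alpha)
    (mono_coef_bounded alpha) hg.
  move=> /le_cvg_rnorm; apply; exists (mono_deg alpha).+1 => // n /= an.
  by rewrite mono_coef_partial_sum // subrr rnorm0.
rewrite -mono_coefB mulf_eq0 invr_eq0 (negPf (dot_mono_neq0 _)) orbF.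
by move/eqP.
Qed.

(** The shifted monomials are again orthogonal, so the series of z_i f, whose
terms grow at most by the factor C, converges in the space. *)
Lemma coordinate_multiplier i (C : R) :
  (forall alpha, rnorm (e (shift_index i alpha)) <= C * rnorm (e alpha)) ->
  Mult H (fun z => (val z : 'rV[R[i]^o]_d) ord0 i).
Proof.
move=> hC f.
pose v alpha := mono_coef f alpha *: e (shift_index i alpha).
have [l hl] : exists l : H, (fun N => \sum_(alpha <- indices_below d N) v alpha) @ \oo --> l.
  apply: (@orthogonal_family_cvg _ (C ^+ 2 * rnorm f ^+ 2)) => [alpha beta ab|N].
    by rewrite dot_scaled_mono // (inj_eq (@shift_index_inj _ _)).
  apply: le_trans (_ : C ^+ 2 * \sum_(alpha <- indices_below d N)
      rnorm (mono_coef f alpha *: e alpha) ^+ 2 <= _); last first.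
    by rewrite ler_wpM2l ?sqr_ge0 ?bessel.
  rewrite mulr_sumr; apply: ler_sum => alpha _.
  have h : rnorm (v alpha) <= C * rnorm (mono_coef f alpha *: e alpha).
    by rewrite !rnormZ mulrCA ler_wpM2l ?rnorm_ge0.
  rewrite -exprMn lerXn2r ?nnegrE ?rnorm_ge0 //.
  exact: le_trans (rnorm_ge0 _) h.
exists l => //; apply/funext => x /=.
have lx := cvg_bounded_functional (fun f g => evB f g x) (ev_bounded x) hl.
have fx := cvg_bounded_functional (fun f g => evB f g x) (ev_bounded x) (@partial_sum_cvg f).
pose c := (val x : 'rV[R[i]^o]_d) ord0 i.
have cx : (fun N => c * ev (partial_sum N f) x : R[i]^o) @ \oo -->
    (c * ev f x : R[i]^o) by exact: (@cvgZl_tmp _ R[i]^o _ _ _ c _ _ fx).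
have uE : (fun N => ev (\sum_(alpha <- indices_below d N) v alpha) x) =
    (fun N => c * ev (partial_sum N f) x).
  apply/funext => N; rewrite ev_partial_sum ev_sum mulr_sumr.
  by apply: eq_bigr => alpha _; rewrite evZ ev_mono monomial_shift mulrCA.
rewrite uE in lx; exact: (@norm_cvg_unique _ R[i]^o _ _ _ _ lx cx).
Qed.

End Expansion.

(** * Polynomials that are small near zero *)

Section Asymptotics.
Variable R : realType.

Lemma eq0_le_small (x K delta : R) : 0 <= x -> 0 < delta ->
  (forall t, 0 < t < delta -> x <= K * t) -> x = 0.
Proof.
move=> x0 d0 h; apply/eqP; rewrite eq_le x0 andbT leNgt; apply/negP => xp.
have K1 : 0 < `|K| + 1 by rewrite ltr_wpDl.
pose t := Num.min (delta / 2) (x / (2 * (`|K| + 1))).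
have t0 : 0 < t by rewrite lt_min !divr_gt0 // mulr_gt0.
have td : t < delta.
  by apply: le_lt_trans (_ : delta / 2 < _); [rewrite ge_min lexx | lra].
have := h t; rewrite t0 td => /(_ isT); apply/negP; rewrite -ltNge.
apply: le_lt_trans (_ : (`|K| + 1) * t < x).
  by apply: ler_wpM2r; [exact: ltW|apply: le_trans (ler_norm _) _; rewrite lerDl].
apply: le_lt_trans (_ : x / 2 < x); last by lra.
apply: le_trans (_ : (`|K| + 1) * (x / (2 * (`|K| + 1))) <= _).
  by rewrite ler_wpM2l ?(ltW K1) // ge_min lexx orbT.
by rewrite le_eqVlt; apply/orP; left; apply/eqP; field; rewrite gt_eqF.
Qed.

Lemma rnorm_horner_le (p : {poly R[i]}) (t : R) : 0 <= t <= 1 ->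
  rnorm p.[t%:C] <= \sum_(k < size p) rnorm p`_k.
Proof.
move=> /andP[t0 t1]; rewrite horner_coef; apply: le_trans (rnorm_sum _ _ _) _.
apply: ler_sum => k _; rewrite rnormM rnormX rnorm_real ger0_norm //.
by rewrite ler_piMr ?rnorm_ge0 // exprn_ile1.
Qed.

(** This is the form of uniqueness of Taylor coefficients used to identify the
coefficients of a product: no manipulation of infinite series is needed. *)
Lemma coef_eq0_small N (p : {poly R[i]}) (C delta : R) : 0 < delta ->
  (forall t, 0 < t < delta -> rnorm p.[t%:C] <= C * t ^+ N) ->
  forall k, (k < N)%N -> p`_k = 0.
Proof.
elim: N p C delta => // N ih p C delta d0 hp.
(* The constant coefficient vanishes and q = p / X satisfies the bound of order N. *)
pose q := drop_poly 1 p.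
have pE (t : R) : p.[t%:C] = p`_0 + q.[t%:C] * t%:C.
  rewrite -{1}(poly_take_drop 1 p) hornerD hornerM hornerXn expr1; congr (_ + _).
  by rewrite horner_poly big_ord_recl big_ord0 addr0 expr0 mulr1.
have p0 : p`_0 = 0.
  apply/eqP; rewrite -rnorm_eq0; apply/eqP.
  pose K := \sum_(k < size q) rnorm q`_k.
  apply: (@eq0_le_small _ (`|C| + K) (Num.min delta 1)) (rnorm_ge0 _) _ _.
    by rewrite lt_min d0 ltr01.
  move=> t; rewrite lt_min => /and3P[t0 td t1].
  have -> : p`_0 = p.[t%:C] - q.[t%:C] * t%:C by rewrite pE addrK.
  apply: le_trans (rnormB _ _) _; rewrite mulrDl lerD //.
    apply: le_trans (hp t _) _; first by rewrite t0.
    apply: le_trans (_ : `|C| * t ^+ N.+1 <= _).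
      by rewrite ler_wpM2r ?exprn_ge0 ?(ltW t0) // ler_norm.
    by rewrite ler_wpM2l // exprS ler_piMr ?(ltW t0) // exprn_ile1 // ltW.
  rewrite rnormM rnorm_real gtr0_norm // ler_wpM2r ?(ltW t0) //.
  by rewrite rnorm_horner_le // !ltW.
case=> [//|k]; rewrite ltnS => kN.
have -> : p`_k.+1 = q`_k by rewrite coef_drop_poly addn1.
apply: (ih q C delta d0) kN => t /andP[t0 td].
have := hp t; rewrite pE p0 add0r t0 td => /(_ isT).
by rewrite rnormM rnorm_real gtr0_norm // exprSr mulrA ler_pM2r.
Qed.

Lemma geometric_tail_le (x : R) m n : 0 <= x <= 2^-1 -> (m <= n)%N ->
  \sum_(m <= k < n) x ^+ k <= 2 * x ^+ m.
Proof.
move=> /andP[x0 x1] mn.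
apply: le_trans (_ : 2 * x ^+ m - 2 * x ^+ n <= _); last first.
  by rewrite gerDl oppr_le0 mulr_ge0 ?exprn_ge0.
elim: n mn => [|n ih]; first by rewrite leqn0 => /eqP ->; rewrite big_geq ?subrr.
rewrite leq_eqVlt => /orP[/eqP ->|]; first by rewrite big_geq ?subrr.
rewrite ltnS => mn; rewrite big_nat_recr //=.
have := ih mn; rewrite exprSr.
have : x ^+ n * x <= x ^+ n * 2^-1 by rewrite ler_wpM2l ?exprn_ge0.
lra.
Qed.

End Asymptotics.

(** * Points of the natural domain *)

Section NaturalDomain.
Variables (R : realType) (d : nat) (H : weighted_hardy_space R d).

Local Notation a := (whs_coef H).
Local Notation X := (natural_domain d a).

Lemma gen_fun_term_le (t : R) n : 0 <= t -> (gen_fun a t < +oo)%E ->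
  a n * t ^+ n <= fine (gen_fun a t).
Proof.
have [_ a0 _] := whs_generating H.
move=> t0 fin; have ge0 k : (0 <= (a k * t ^+ k)%:E)%E.
  by rewrite lee_fin mulr_ge0 ?exprn_ge0 // ltW.
have fn : (gen_fun a t \is a fin_num)%E.
  by rewrite ge0_fin_numE // nneseries_ge0.
rewrite -lee_fin fineK //.
have := @nneseries_lim_ge R (fun k => (a k * t ^+ k)%:E) xpredT 0 n.+1 (fun k _ _ => ge0 k).
apply: le_trans; rewrite big_nat_recr //= leeDr //.
by apply: sume_ge0.
Qed.

Lemma sqnorm_ge0 (z : 'rV[R[i]^o]_d) : 0 <= sqnorm z.
Proof. by apply: sumr_ge0 => j _; rewrite normc_rnorm sqr_ge0. Qed.

Lemma gen_fun_le (q t : R) : 0 <= q -> q <= t -> (gen_fun a q <= gen_fun a t)%E.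
Proof.
have [_ a0 _] := whs_generating H => q0 qt.
apply: lee_nneseries => k _; first by rewrite lee_fin mulr_ge0 ?exprn_ge0 // ltW.
rewrite lee_fin ler_wpM2l ?(ltW (a0 k)) // lerXn2r ?nnegrE //.
exact: le_trans q0 qt.
Qed.

Lemma natural_domain_finite (z : 'rV[R[i]^o]_d) :
  (gen_fun a (sqnorm z) < +oo)%E -> X z.
Proof.
move=> fin; have : ((sqnorm z)%:E <= conv_radius a)%E.
  by apply: ereal_sup_ubound; exists (sqnorm z) => //; split => //; exact: sqnorm_ge0.
rewrite /natural_domain; case: (conv_radius a) => [r2| |] //.
rewrite lee_fin => zr; case: ifPn => //= /eqP inf.
by rewrite lt_neqAle zr andbT; apply/eqP => zE; move: fin; rewrite zE inf.
Qed.

(** Convergence of G at one positive t bounds the terms a_n t^n and places a ball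
inside the domain. The value of s is taken below 1 so that s^(2n) <= s^n, which
saves square roots in the estimates of coefficients below. *)
Lemma natural_domain_small : exists s B : R, [/\ 0 < s, s < 1,
  forall n, a n * s ^+ n <= B & forall z : 'rV[R[i]^o]_d, sqnorm z < s -> X z].
Proof.
have [_ a0] := whs_generating H.
move=> /ereal_sup_gt[_ [t [t0 tfin] <-]]; rewrite lte_fin => tp.
pose s := Num.min t 2^-1.
exists s, (fine (gen_fun a t)); split; first by rewrite lt_min tp invr_gt0 ltr0n.
- by apply: le_lt_trans (_ : 2^-1 < 1); [rewrite ge_min lexx orbT | lra].
- move=> n; apply: le_trans (gen_fun_term_le n t0 tfin).
  rewrite ler_wpM2l ?(ltW (a0 n)) // lerXn2r ?nnegrE //.
    by rewrite le_min t0 invr_ge0 ler0n.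
  by rewrite ge_min lexx.
move=> z zs; apply: natural_domain_finite; apply: le_lt_trans tfin.
apply: gen_fun_le; first exact: sqnorm_ge0.
by rewrite ltW // (lt_le_trans zs) // ge_min lexx.
Qed.

End NaturalDomain.

(** * Taylor coefficients along an axis *)

Section Axis.
Variables (R : realType) (d : nat) (H : weighted_hardy_space R d) (i : 'I_d).

Local Notation a := (whs_coef H).
Local Notation X := (natural_domain d a).
Local Notation ev := (hfs_eval H).
Local Notation e := (whs_mono H).
Implicit Types (f g h : H) (alpha beta : {ffun 'I_d -> nat}).

Definition axis_point (t : R) : 'rV[R[i]^o]_d :=
  \row_j (if j == i then t%:C else 0).

Lemma sqnorm_axis (t : R) : sqnorm (axis_point t) = t ^+ 2.
Proof.
rewrite /sqnorm (bigD1 i) //= big1 ?addr0 => [|j /negPf ji].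
  by rewrite mxE eqxx normc_rnorm rnorm_real real_normK ?num_real.
by rewrite mxE ji Normc.normc0 expr0n.
Qed.

Lemma monomial_axis (t : R) alpha : monomial (axis_point t ord0) alpha =
  if alpha == axis_index i (mono_deg alpha) then t%:C ^+ mono_deg alpha else 0.
Proof.
case: eqP => [aE|aN].
  rewrite /monomial (bigD1 i) //= big1 => [|j /negPf ji]; last first.
    by rewrite aE ffunE ji expr0.
  by rewrite mxE eqxx mulr1 [in LHS]aE ffunE eqxx.
have [j ji aj] : exists2 j, j != i & alpha j != 0%N.
  apply: contrapT => nj; apply: aN; apply/ffunP => j; rewrite ffunE.
  have z k : k != i -> alpha k = 0%N.
    by move=> ki; apply/eqP/negPn/negP => ak; apply: nj; exists k.
  have [->|/z //] := eqVneq j i.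
  by rewrite /mono_deg (bigD1 i) //= big1 ?addn0.
rewrite /monomial (bigD1 j) //= mxE (negPf ji) expr0n.
by rewrite (negPf aj) mul0r.
Qed.

Definition axis_coef f k : R[i] := mono_coef f (axis_index i k).

Lemma ev_partial_sum_axis N f (x : X) (t : R) : val x = axis_point t ->
  ev (partial_sum N f) x = \sum_(k < N) axis_coef f k * t%:C ^+ k.
Proof.
move=> xE; rewrite ev_partial_sum xE big_indices_below; apply: eq_bigr => k _.
rewrite (bigD1_seq (axis_index i k)) ?uniq_indices_of_degree //=; last first.
  by rewrite mem_indices_of_degree mono_deg_axis.
rewrite monomial_axis mono_deg_axis eqxx big_seq_cond big1 ?addr0 // => alpha.
rewrite mem_indices_of_degree => /andP[/eqP ak ai].
by rewrite monomial_axis ak (negPf ai) mulr0.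
Qed.

Lemma rnorm_mono_axis k : rnorm (e (axis_index i k)) ^+ 2 = (a k)^-1.
Proof.
rewrite rnorm_mono mono_deg_axis mono_fact_axis invfM mulrC divfK //.
Qed.

Definition jet N f : {poly R[i]} := \poly_(k < N) axis_coef f k.

(** From |f_k|^2 <= ||f||^2 a_k the coefficients grow at most geometrically, so
the tail of the series on the axis is bounded by twice its first term. The point
evaluation is bounded, hence the series of f converges there to the value. *)
Theorem taylor_axis N f : exists C delta : R, [/\ 0 <= C, 0 < delta, delta <= 1 &
  forall t (x : X), 0 < t < delta -> val x = axis_point t ->
    rnorm (ev f x - (jet N f).[t%:C]) <= C * t ^+ N].
Proof.
have [s [B [s0 s1 hB _]]] := natural_domain_small H.
have [_ a0 _] := whs_generating H.
have B0 : 0 <= B by apply: le_trans (hB 0%N); rewrite expr0 mulr1 ltW.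
pose D := rnorm f ^+ 2 * B + 1.
have D1 : 1 <= D by rewrite lerDr mulr_ge0 ?sqr_ge0.
(* The 1 added in D replaces a square root: y^2 <= D - 1 implies y <= D. *)
have fk k : rnorm (axis_coef f k) <= D / s ^+ k.
  rewrite ler_pdivlMr ?exprn_gt0 //.
  set y := _ * _.
  have y0 : 0 <= y by rewrite mulr_ge0 ?rnorm_ge0 ?exprn_ge0 ?ltW.
  suff y2 : y ^+ 2 <= D - 1 by nra.
  rewrite addrK; have c1 := rnorm_mono_coef f (axis_index i k).
  have e0 := rnorm_mono_gt0 H (axis_index i k).
  have : (rnorm (axis_coef f k) * rnorm (e (axis_index i k))) ^+ 2 <= rnorm f ^+ 2.
    by rewrite lerXn2r ?nnegrE ?mulr_ge0 ?rnorm_ge0.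
  rewrite exprMn rnorm_mono_axis ler_pdivrMr ?a0 // => c2.
  rewrite exprMn -exprM mulnC exprM.
  have : (s ^+ 2) ^+ k <= s ^+ k.
    by rewrite lerXn2r ?nnegrE ?sqr_ge0 ?(ltW s0) // expr2 ler_piMr ?ltW.
  move=> sk; apply: le_trans (_ : rnorm f ^+ 2 * a k * s ^+ k <= _); last first.
    by rewrite -mulrA ler_wpM2l ?sqr_ge0.
  by apply: ler_pM => //; [exact: sqr_ge0|exact/exprn_ge0/sqr_ge0].
exists (D * 2 / s ^+ N), (s / 2); split => //.
- by rewrite divr_ge0 ?exprn_ge0 ?(ltW s0) // mulr_ge0 // (le_trans ler01).
- by rewrite divr_gt0.
- by lra.
move=> t x /andP[t0 ts] xE.
have lim := cvg_bounded_functional (fun f g => evB f g x) (ev_bounded x)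
  (@partial_sum_cvg _ _ _ f).
apply: (@le_cvg_rnorm _ R[i]^o _ _ _ _ lim).
exists N => // M /= NM; rewrite (ev_partial_sum_axis _ _ xE).
rewrite /jet horner_poly.
rewrite -!(big_mkord xpredT (fun k => axis_coef f k * t%:C ^+ k)).
rewrite (big_cat_nat _ NM) //= addrAC subrr add0r.
apply: le_trans (rnorm_sum _ _ _) _.
apply: le_trans (_ : \sum_(N <= k < M) D * (t / s) ^+ k <= _).
  apply: ler_sum => k _; rewrite rnormM rnormX rnorm_real gtr0_norm //.
  by rewrite exprMn exprVn mulrCA mulrC ler_wpM2l ?exprn_ge0 ?(ltW t0) // fk.
rewrite -mulr_sumr -!mulrA ler_wpM2l ?(le_trans ler01) //.
rewrite [_^-1 * _]mulrC -exprVn -exprMn; apply: geometric_tail_le => //.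
rewrite divr_ge0 ?(ltW t0) ?(ltW s0) //= ler_pdivrMr //.
by rewrite mulrC ltW.
Qed.

(** Multiplying the Taylor approximations of f and g to order n + 1 gives one of
fg; its coefficients up to n must be those of h. *)
Theorem axis_coef_mul f g h n : ev h = ev f \* ev g ->
  axis_coef h n = \sum_(k < n.+1) axis_coef f k * axis_coef g (n - k).
Proof.
move=> hE.
have [s [_ [s0 s1 _ hX]]] := natural_domain_small H.
have [C1 [d1 [C10 d10 d11 h1]]] := taylor_axis n.+1 f.
have [C2 [d2 [C20 d20 d21 h2]]] := taylor_axis n.+1 g.
have [C3 [d3 [C30 d30 d31 h3]]] := taylor_axis n.+1 h.
have [C4 [d4 [C40 d40 d41 h4]]] := taylor_axis 0 f.
have [C5 [d5 [C50 d50 d51 h5]]] := taylor_axis 0 g.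
pose p := jet n.+1 h - jet n.+1 f * jet n.+1 g.
have : p`_n = 0.
  apply: (@coef_eq0_small _ n.+1 p (C3 + (C1 * C5 + C4 * C2 + C1 * C2))
    (Num.min s (Num.min d1 (Num.min d2 (Num.min d3 (Num.min d4 d5)))))) => //.
    by rewrite !lt_min s0 d10 d20 d30 d40 d50.
  move=> t; rewrite !lt_min => /and5P[t0 ts t1 t2 /and3P[t3 t4 t5]].
  have t01 : t <= 1 by rewrite ltW // (lt_le_trans t1).
  have /hX xt : sqnorm (axis_point t) < s.
    by rewrite sqnorm_axis (le_lt_trans _ ts) // expr2 ler_piMr // ltW.
  pose x : X := exist _ (axis_point t) (mem_set xt).
  have xE : val x = axis_point t by [].
  have {}h1 := h1 t x; rewrite t0 t1 in h1; have {}h1 := h1 isT xE.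
  have {}h2 := h2 t x; rewrite t0 t2 in h2; have {}h2 := h2 isT xE.
  have {}h3 := h3 t x; rewrite t0 t3 in h3; have {}h3 := h3 isT xE.
  have {}h4 := h4 t x; rewrite t0 t4 in h4; have {}h4 := h4 isT xE.
  have {}h5 := h5 t x; rewrite t0 t5 in h5; have {}h5 := h5 isT xE.
  rewrite /jet !poly_def !big_ord0 !horner0 !subr0 expr0 !mulr1 in h4 h5.
  have hx : ev h x = ev f x * ev g x by rewrite hE.
  rewrite hornerD hornerN hornerM.
  move: h1 h2 h3 h4 h5; rewrite hx.
  set F := ev f x; set G := ev g x; set jf := (jet _ f).[_]; set jg := (jet _ g).[_].
  set jh := (jet _ h).[_] => h1 h2 h3 h4 h5.
  have -> : jh - jf * jg = - (F * G - jh) +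
      ((F - jf) * G + (F * (G - jg) - (F - jf) * (G - jg))) by ring.
  have tn : 0 <= t ^+ n.+1 by rewrite exprn_ge0 // ltW.
  have tn1 : t ^+ n.+1 <= 1 by rewrite exprn_ile1 // ltW.
  have k1 : rnorm ((F - jf) * G) <= C1 * t ^+ n.+1 * C5.
    by rewrite rnormM ler_pM ?rnorm_ge0.
  have k2 : rnorm (F * (G - jg)) <= C4 * (C2 * t ^+ n.+1).
    by rewrite rnormM ler_pM ?rnorm_ge0.
  have k3 : rnorm ((F - jf) * (G - jg)) <= C1 * t ^+ n.+1 * C2.
    rewrite rnormM ler_pM ?rnorm_ge0 //; apply: le_trans h2 _.
    by rewrite ler_piMr.
  have := rnormD (- (F * G - jh))
    ((F - jf) * G + (F * (G - jg) - (F - jf) * (G - jg))).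
  have := rnormD ((F - jf) * G) (F * (G - jg) - (F - jf) * (G - jg)).
  have := rnormB (F * (G - jg)) ((F - jf) * (G - jg)).
  rewrite rnormN; lra.
rewrite /p coefB coefM /jet coef_poly ltnSn => /eqP; rewrite subr_eq0 => /eqP ->.
apply: eq_bigr => k _; rewrite !coef_poly ltn_ord.
by rewrite ltnS leq_subr.
Qed.

End Axis.

(** * Multipliers with a linear term *)

Section Multipliers.
Variables (R : realType) (d : nat) (H : weighted_hardy_space R d).

Local Notation a := (whs_coef H).
Local Notation X := (natural_domain d a).
Local Notation ev := (hfs_eval H).
Local Notation e := (whs_mono H).
Local Notation one := (e [ffun=> 0%N]).
Implicit Types (f g h : H) (alpha beta : {ffun 'I_d -> nat}).

Lemma ev_one x : ev one x = 1.
Proof. by rewrite ev_mono monomial0. Qed.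

Lemma multiplier_in_space l : Mult H l -> exists h, ev h = l.
Proof.
move=> /(_ one)[h _ hE]; exists h; rewrite hE.
by apply/funext => x /=; rewrite ev_one mulr1.
Qed.

Lemma axis_coef_axis (i : 'I_d) n k : axis_coef i (e (axis_index i n)) k = (n == k)%:R.
Proof. by rewrite /axis_coef mono_coef_mono axis_index_eq. Qed.

(** The Cauchy product formula exhibits f |-> (phi f)_(n+1) as a finite
combination of coefficients of f, so that it is bounded without knowing that
multiplication by phi is a bounded operator. *)
Theorem multiplier_shift_bound (i : 'I_d) phi : Mult H (ev phi) ->
  exists2 C, 0 <= C & forall n, rnorm (axis_coef i phi 1) * rnorm (e (axis_index i n.+1)) <=
    C * rnorm (e (axis_index i n)).
Proof.
move=> mphi.
pose T n f : R[i] := (rnorm (e (axis_index i n.+1)))%:C *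
  \sum_(k < n.+2) axis_coef i phi k * axis_coef i f (n.+1 - k).
have TE n f g : ev g = ev phi \* ev f ->
    T n f = (rnorm (e (axis_index i n.+1)))%:C * axis_coef i g n.+1.
  by move=> gE; rewrite (axis_coef_mul _ _ gE).
have Tlin n (c : R[i]) f g : T n (c *: f + g) = c * T n f + T n g.
  rewrite /T mulrCA -mulrDr; congr (_ * _).
  rewrite mulr_sumr -big_split /=; apply: eq_bigr => k _.
  by rewrite /axis_coef mono_coef_linear mulrDr mulrCA.
have Tbound n : exists M, forall f, rnorm (T n f) <= M * rnorm f.
  exists (rnorm (e (axis_index i n.+1)) * \sum_(k < n.+2)
    rnorm (axis_coef i phi k) / rnorm (e (axis_index i (n.+1 - k)))) => f.
  rewrite /T rnormM rnorm_real ger0_norm ?rnorm_ge0 // -mulrA.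
  rewrite ler_wpM2l ?rnorm_ge0 // mulr_suml.
  apply: le_trans (rnorm_sum _ _ _) _; apply: ler_sum => k _.
  rewrite rnormM -mulrA ler_wpM2l ?rnorm_ge0 // mulrC ler_pdivlMr ?rnorm_mono_gt0 //.
  exact: rnorm_mono_coef.
have Tpoint f : exists M, forall n, rnorm (T n f) <= M.
  have [g _ gE] := mphi f; exists (rnorm g) => n.
  rewrite (TE n f g gE) rnormM rnorm_real ger0_norm ?rnorm_ge0 // mulrC.
  exact: rnorm_mono_coef.
have [M hM] := uniform_boundedness Tlin Tbound Tpoint.
exists `|M| => // n.
have <- : rnorm (T n (e (axis_index i n))) =
    rnorm (axis_coef i phi 1) * rnorm (e (axis_index i n.+1)).
  rewrite /T big_ord_recl big_ord_recl big1 => [|k _]; last first.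
    rewrite axis_coef_axis lift0 lift0 subSS.
    by rewrite (_ : (n == _) = false) ?mulr0 //; move: (ltn_ord k); lia.
  rewrite !axis_coef_axis lift0 /= subn0 subSS subn0 eqxx addr0 mulr1.
  rewrite (ltn_eqF (ltnSn n)) mulr0 add0r.
  by rewrite rnormM rnorm_real ger0_norm ?rnorm_ge0 // mulrC.
apply: le_trans (hM _ _) _; rewrite ler_wpM2r ?rnorm_ge0 //.
exact: ler_norm.
Qed.

(** The previous bound says that a_n / a_(n+1) <= K^2, and this ratio dominates
the growth of the norms of all monomials, not only of the powers of z_i. *)
Theorem coordinate_multiplier_of_linear_term (i : 'I_d) phi : Mult H (ev phi) ->
  axis_coef i phi 1 != 0 -> Mult H (fun z => (val z : 'rV[R[i]^o]_d) ord0 i).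
Proof.
move=> mphi phi1.
have [C C0 hC] := multiplier_shift_bound i mphi.
have p0 : 0 < rnorm (axis_coef i phi 1) by rewrite rnorm_gt0.
have [_ a0 _] := whs_generating H.
pose K := C / rnorm (axis_coef i phi 1).
have K0 : 0 <= K by apply: divr_ge0 => //; exact: ltW.
have aK n : a n / a n.+1 <= K ^+ 2.
  have : rnorm (e (axis_index i n.+1)) <= K * rnorm (e (axis_index i n)).
    by rewrite mulrAC ler_pdivlMr // mulrC.
  have r0 k := rnorm_ge0 (e (axis_index i k)).
  rewrite -(ler_pXn2r (isT : (0 < 2)%N)) ?nnegrE ?(mulr_ge0 K0 (r0 n)) //.
  rewrite exprMn !rnorm_mono_axis ler_pdivlMr //.
  by rewrite mulrC.
apply: (@coordinate_multiplier _ _ H i K) => alpha.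
rewrite -(ler_pXn2r (isT : (0 < 2)%N)) ?nnegrE ?(mulr_ge0 K0) ?rnorm_ge0 //.
rewrite exprMn rnorm_mono_shift [leRHS]mulrC -mulrA.
rewrite ler_wpM2l ?sqr_ge0 //; apply: le_trans (aK (mono_deg alpha)).
apply: ler_piMl; first by apply: divr_ge0; apply: ltW; exact: a0.
by rewrite ler_pdivrMr ?ltr0n // mul1r ler_nat ltnS le_mono_deg.
Qed.

Lemma monomial_multiplier alpha :
  (forall i : 'I_d, Mult H (fun z => (val z : 'rV[R[i]^o]_d) ord0 i)) ->
  Mult H (ev (e alpha)).
Proof.
move=> hz; elim/multi_index_ind: alpha => [|i beta ih] f.
  by exists f => //; apply/funext => x /=; rewrite ev_one mul1r.
have [g _ gE] := ih f; have [h _ hE] := hz i g.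
exists h => //; rewrite hE gE; apply/funext => x /=.
by rewrite !ev_mono monomial_shift mulrA.
Qed.

Lemma partial_sum_multiplier N f :
  (forall i : 'I_d, Mult H (fun z => (val z : 'rV[R[i]^o]_d) ord0 i)) ->
  Mult H (ev (partial_sum N f)).
Proof.
move=> hz; rewrite /partial_sum.
elim/big_rec: _ => [|alpha s _ ms] g.
  by exists 0 => //; rewrite !linear0; apply/funext => x /=; rewrite mul0r.
have [u _ uE] := ms g; have [v _ vE] := monomial_multiplier alpha hz g.
exists (mono_coef f alpha *: v + u) => //; apply/funext => x.
rewrite evD evZ uE vE /= evD evZ.
by rewrite mulrDl mulrA.
Qed.

End Multipliers.

(** * Cyclic vectors and partially multiplicative functionals *)

Section Consistency.
Variables (R : realType) (d : nat) (H : weighted_hardy_space R d).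

Local Notation a := (whs_coef H).
Local Notation X := (natural_domain d a).
Local Notation ev := (hfs_eval H).
Local Notation e := (whs_mono H).
Local Notation one := (e [ffun=> 0%N]).
Implicit Types (f g h : H) (alpha beta : {ffun 'I_d -> nat}).

Definition coordinate_multipliers : Prop :=
  forall i : 'I_d, Mult H (fun z => (val z : 'rV[R[i]^o]_d) ord0 i).

Lemma axis_coef_bounded i k : bounded_functional (fun f : H => axis_coef i f k).
Proof. exact: mono_coef_bounded. Qed.

Lemma axis_coefB i k f g : axis_coef i (f - g) k = axis_coef i f k - axis_coef i g k.
Proof. by rewrite /axis_coef mono_coefB. Qed.

Lemma partial_sum_closure f : closure (range (fun N => partial_sum N f)) f.
Proof.
move=> B nB; have [N _ hN] := partial_sum_cvg nB.
by exists (partial_sum N f); split; [exists N | apply: hN => /=].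
Qed.

Lemma multipliers_dense : coordinate_multipliers -> dense (Mult_in_space H).
Proof.
move=> hz O [f Of] oO.
have [_ [[N _ <-] ON]] := partial_sum_closure (open_nbhs_nbhs (conj oO Of)).
by exists (partial_sum N f); split => //; exact: partial_sum_multiplier.
Qed.

Lemma dense_orbit_one : dense (Mult_in_space H) -> closure (Mult_orbit one) = setT.
Proof.
move=> dM; apply/seteqP; split => // f _ B; rewrite nbhsE => -[U [oU Uf] UB].
have [g [Ug mg]] := dM U (ex_intro _ f Uf) oU.
exists g; split; last exact: UB.
by exists (ev g) => //; apply/funext => x /=; rewrite ev_one mulr1.
Qed.

(** If all multipliers had zero linear term, the pair (g_0, g_1) would be
proportional to (c_0, c_1) for all g in the orbit of c, whereas it takes the
values (1, 0) and (0, 1) on the whole space. *)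
Lemma cyclic_linear_term (i : 'I_d) (c : H) : closure (Mult_orbit c) = setT ->
  exists2 phi : H, Mult H (ev phi) & axis_coef i phi 1 != 0.
Proof.
move=> clc; apply: contrapT => nphi.
have orbit g : Mult_orbit c g -> exists phi : H,
    axis_coef i g 0 = axis_coef i phi 0 * axis_coef i c 0 /\
    axis_coef i g 1 = axis_coef i phi 0 * axis_coef i c 1.
  move=> [l ml gE]; have [phi pE] := multiplier_in_space ml.
  have p1 : axis_coef i phi 1 = 0.
    by apply/eqP/negPn/negP => p1; apply: nphi; exists phi => //; rewrite pE.
  exists phi; rewrite -pE in gE; rewrite !(axis_coef_mul _ _ gE).
  by rewrite !big_ord_recl !big_ord0 p1 /= !addr0 mul0r addr0.
have scaled (z : R[i]) k : bounded_functional (fun f : H => z * axis_coef i f k).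
  have [M M0 hM] := bounded_functional_rnorm (axis_coef_bounded i k).
  apply: (@rnorm_bounded_functional _ _ _ (rnorm z * M)) => f.
  by rewrite rnormM -mulrA ler_wpM2l ?rnorm_ge0.
have scaledB (z : R[i]) k f g :
    z * axis_coef i (f - g) k = z * axis_coef i f k - z * axis_coef i g k.
  by rewrite axis_coefB mulrBr.
have all f : closure (Mult_orbit c) f by rewrite clc.
have rel f : axis_coef i c 0 * axis_coef i f 1 = axis_coef i c 1 * axis_coef i f 0.
  apply: (bounded_functional_eq_closure (scaledB _ _) (scaled _ _) (scaledB _ _)
    (scaled _ _) _ (all f)) => g /orbit[phi [-> ->]].
  by ring.
have c0 : axis_coef i c 0 = 0.
  have := rel (e (axis_index i 1)).
  by rewrite !axis_coef_axis mulr1 mulr0.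
have f0 f : 1 * axis_coef i f 0 = 0 * axis_coef i f 0.
  apply: (bounded_functional_eq_closure (scaledB _ _) (scaled _ _) (scaledB _ _)
    (scaled _ _) _ (all f)) => g /orbit[phi [-> _]].
  by rewrite c0 !mulr0.
have := f0 (e (axis_index i 0)).
by rewrite axis_coef_axis mul1r mul0r => /eqP; rewrite oner_eq0.
Qed.

Section OneJet.
Variable i : 'I_d.

Definition one_jet (f : H) : R[i]^o := axis_coef i f 0 + axis_coef i f 1.

Lemma one_jet_linear : linear one_jet.
Proof.
move=> c f g; rewrite /one_jet /axis_coef !mono_coef_linear /GRing.scale /=.
by rewrite mulrDr addrACA.
Qed.

HB.instance Definition _ := GRing.isLinear.Build _ _ _ _ one_jet one_jet_linear.

(** Were all multipliers without linear term, the Leibniz rule would make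
one_jet partially multiplicative; but its values at z_i and z_i^2 are 1 and
0. *)
Lemma consistent_linear_term : algebraically_consistent H ->
  exists2 phi : H, Mult H (ev phi) & axis_coef i phi 1 != 0.
Proof.
move=> cons; apply: contrapT => nphi.
have p1 phi : Mult H (ev phi) -> axis_coef i phi 1 = 0.
  by move=> mp; apply/eqP/negPn/negP => p1; apply: nphi; exists phi.
have [] := cons one_jet.
  split.
  - have [M M0 hM] := bounded_functional_rnorm (axis_coef_bounded i 0).
    have [M' M'0 hM'] := bounded_functional_rnorm (axis_coef_bounded i 1).
    apply: (@rnorm_bounded_functional _ _ _ (M + M')) => f.
    by apply: le_trans (rnormD _ _) _; rewrite mulrDl lerD.
  - exists (e (axis_index i 0)).
    by rewrite /= /one_jet !axis_coef_axis /= mulr0n addr0 oner_eq0.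
  - move=> phi g h mp hE /=; rewrite /one_jet !(axis_coef_mul _ _ hE).
    by rewrite !big_ord_recl !big_ord0 p1 //= !addr0 mul0r addr0 mulrDr.
move=> _ _ /(_ (e (axis_index i 1)) (e (axis_index i 1)) (e (axis_index i 2))).
have -> : ev (e (axis_index i 2)) = ev (e (axis_index i 1)) \* ev (e (axis_index i 1)).
  apply/funext => x /=; rewrite !ev_mono !axis_indexS axis_index0.
  by rewrite !monomial_shift monomial0 mulr1.
move=> /(_ erefl) /=; rewrite /one_jet !axis_coef_axis /= mulr0n mulr1n !add0r mul1r.
by move=> /eqP; rewrite eq_sym oner_eq0.
Qed.

End OneJet.

Lemma rnorm_monomial (x : 'I_d -> R[i]) alpha :
  rnorm (monomial x alpha) ^+ 2 = monomial (fun i => rnorm (x i) ^+ 2) alpha.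
Proof.
rewrite /monomial; elim/big_rec2: _ => [|i u v _ <-]; first by rewrite rnorm1 expr1n.
by rewrite rnormM exprMn rnormX -!exprM mulnC.
Qed.

Section Evaluation.
Hypothesis hz : coordinate_multipliers.
Variable rho : {linear H -> R[i]^o}.
Hypothesis rho_partial : partially_multiplicative_functional rho.

Let lambda (i : 'I_d) : R[i] := rho (e (axis_index i 1)).

Lemma functional_monomial alpha : rho (e alpha) = monomial lambda alpha.
Proof.
have [_ [f rf] rhoM] := rho_partial.
elim/multi_index_ind: alpha => [|i beta ih].
  have h1 : rho f = rho one * rho f.
    apply: rhoM; first exact: monomial_multiplier.
    by apply/funext => x /=; rewrite ev_one mul1r.
  apply: (mulIf rf); rewrite -h1 monomial0 mul1r //.
rewrite monomial_shift -ih; apply: rhoM; first exact: monomial_multiplier.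
apply/funext => x /=; rewrite !ev_mono axis_indexS axis_index0.
by rewrite !monomial_shift monomial0 mulr1.
Qed.

Let z : 'rV[R[i]^o]_d := \row_i lambda i.

(** The vector v below is the truncated kernel function at lambda. Both rho v and
||v||^2 equal the partial sum S of G(|lambda|^2), so S <= M sqrt S, that is
S <= M^2. *)
Lemma functional_point_sum_le : exists B : R, forall N,
  \sum_(n < N) a n * sqnorm z ^+ n <= B.
Proof.
have [/bounded_functional_rnorm[M M0 hM] _ _] := rho_partial.
have [_ a0 _] := whs_generating H.
exists (M ^+ 2) => N.
pose w alpha := rnorm (monomial lambda alpha) ^+ 2 / rnorm (e alpha) ^+ 2.
pose c alpha := (monomial lambda alpha)^* * ((rnorm (e alpha) ^+ 2)^-1)%:C.
pose v := \sum_(alpha <- indices_below d N) c alpha *: e alpha.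
set S := \sum_(n < N) _.
have SE : S = \sum_(alpha <- indices_below d N) w alpha.
  rewrite big_indices_below; apply: eq_bigr => n _.
  have -> : sqnorm z = \sum_i rnorm (lambda i) ^+ 2.
    by apply: eq_bigr => i _; rewrite mxE normc_rnorm.
  rewrite -multinomial_formula mulr_sumr; apply: eq_big_seq => alpha.
  rewrite mem_indices_of_degree => /eqP an.
  rewrite /w rnorm_monomial rnorm_mono an invf_div.
  by rewrite [RHS]mulrC !mulrA.
have S0 : 0 <= S.
  by rewrite SE; apply: sumr_ge0 => alpha _; rewrite divr_ge0 ?sqr_ge0.
have rv : rho v = S%:C.
  rewrite SE rmorph_sum /= linear_sum; apply: eq_bigr => alpha _.
  rewrite linearZ /= functional_monomial /GRing.scale /= /c /w.
  rewrite rmorphM /= mulrAC; congr (_ * _).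
  by rewrite mulrC -sqr_normc rnormE rmorphXn.
have vS : rnorm v ^+ 2 = S.
  rewrite SE (rnorm_sum_orthogonal (@hfs_normE _ _ _)) ?uniq_indices_below //; last first.
    by move=> alpha beta; exact: dot_scaled_mono.
  apply: eq_bigr => alpha _.
  have r0 : 0 < rnorm (e alpha) ^+ 2 by rewrite exprn_gt0 // rnorm_mono_gt0.
  rewrite rnormZ exprMn /c rnormM exprMn rnorm_real.
  rewrite [`|_|]ger0_norm ?invr_ge0 ?(ltW r0) // /w.
  have -> : rnorm (monomial lambda alpha)^* = rnorm (monomial lambda alpha).
    by rewrite /rnorm normcJ.
  by field; rewrite gt_eqF // rnorm_mono_gt0.
have := hM v; rewrite rv rnorm_real ger0_norm // => SM.
have : S ^+ 2 <= M ^+ 2 * S.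
  by rewrite -vS -exprMn lerXn2r ?nnegrE ?mulr_ge0 ?rnorm_ge0 // vS.
have [->|SN] := eqVneq S 0; first by rewrite sqr_ge0.
by rewrite expr2 ler_pM2r // lt_neqAle eq_sym SN.
Qed.

(** The preceding bound on the partial sums of G is exactly membership of lambda
in the natural domain; then rho and the evaluation at lambda are bounded and
agree on the partial sums of every f. *)
Theorem functional_is_evaluation : exists x : X, forall f, rho f = ev f x.
Proof.
have [rho_bounded _ _] := rho_partial.
have [_ a0 _] := whs_generating H.
have /mem_set Xz : X z.
  have [B hB] := functional_point_sum_le.
  apply: natural_domain_finite; apply: le_lt_trans (ltry B).
  apply: lime_le.
    apply: is_cvg_nneseries => n _ _.
    by rewrite lee_fin mulr_ge0 ?exprn_ge0 ?sqnorm_ge0 // ltW.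
  apply: nearW => N; rewrite big_mkord sumEFin lee_fin; exact: hB.
pose x : X := exist _ z Xz.
exists x => f.
have rhoB u v : rho (u - v) = rho u - rho v :> R[i] by rewrite linearB.
apply: (@bounded_functional_eq_closure _ _ (rho : H -> R[i]) (fun f : H => ev f x)
  _ f rhoB rho_bounded (fun u v => evB u v x) (ev_bounded x) _
  (@partial_sum_closure f)) => _ [N _ <-].
rewrite ev_partial_sum linear_sum; apply: eq_bigr => alpha _.
rewrite linearZ /= functional_monomial; congr (_ * _).
by rewrite /monomial; apply: eq_bigr => i _; rewrite mxE.
Qed.

End Evaluation.

Lemma coordinate_multipliers_consistent :
  coordinate_multipliers -> algebraically_consistent H.
Proof.
move=> hz rho rp; have [rb rn _] := rp; split => // f g h hE.
have [x rhoE] := functional_is_evaluation hz rp.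
by rewrite !rhoE hE.
Qed.

End Consistency.

Theorem theorem5p7 (R : realType) (d : nat) (H : weighted_hardy_space R d) :
  [<-> forall i : 'I_d, Mult H (fun z => (val z : 'rV[R[i]^o]_d) ord0 i);
       Mult H `<=` range (hfs_eval H) /\ dense (Mult_in_space H);
       exists c : H, closure (Mult_orbit c) = setT;
       algebraically_consistent H].
Proof.
tfae.
- move=> hz; split; last exact: multipliers_dense.
  by move=> l /multiplier_in_space[h hl]; exists h.
- by move=> [_ dM]; exists (whs_mono H [ffun=> 0%N]); exact: dense_orbit_one.
- move=> [c clc]; apply: coordinate_multipliers_consistent => i.
  have [phi mphi phi1] := cyclic_linear_term i clc.
  exact: coordinate_multiplier_of_linear_term mphi phi1.
- move=> cons i; have [phi mphi phi1] := consistent_linear_term i cons.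
  exact: coordinate_multiplier_of_linear_term mphi phi1.
Qed.
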